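(* Let $G=(V,E)$ be an undirected graph with $n$ vertices and no self-loops, let $b_i$ ($i\in V$) be nonnegative integers, and let $\delta\in(0,\tfrac1{16}]$. Let $\hat y_{ij}=\hat y_{ji}\ge 0$ be edge values (with $\hat y_{ii}=0$ for all $i$ and $\hat y_{ij}=0$ if $(i,j)\notin E$) satisfying $\sum_{j:(i,j)\in E}\hat y_{ij}\le b_i$ for every $i\in V$. For $U\in\mathcal O_\delta$ put $$\tilde b_U=\Big\lfloor \tfrac{\|U\|_b}{2}\Big\rfloor-\frac{\delta^2\|U\|_b^2}{4},\qquad \hat\lambda_U=\frac{\sum_{(i,j)\in E:\,i,j\in U}\hat y_{ij}}{\tilde b_U},\qquad \hat\lambda=\max_{U\in\mathcal O_\delta}\hat\lambda_U .$$ If $\hat\lambda\ge 1+3\delta$, then the family $L_1=\{U\in\mathcal O_\delta:\hat\lambda_U\ge\hat\lambda-\delta^3\}$ is laminar (for any $U,U'\in L_1$, $U\cap U'$ is $U$, $U'$ or $\emptyset$). Moreover, for every $x\ge 2$, $$\big|\{U\in\mathcal O_\delta:\hat\lambda_U\ge\hat\lambda-\delta^x\}\big|\le n^3+(n/\delta)^{1+\delta^{(x-3)/2}}.$$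
   Context: For $U\subseteq V$, $\|U\|_b=\sum_{i\in U}b_i$. $\mathcal O_\delta$ denotes the family of sets $U\subseteq V$ such that $\|U\|_b$ is odd and $\|U\|_b\le 1/\delta$. Sums over $(i,j)\in E$ count each (undirected) edge once.
   Formalization: Both conclusions (laminarity of L_1 and the count for x ≥ 2) are stated only for the members U of the family that contain no vertex with b_i = 0, since adding such vertices to U changes neither ‖U‖_b nor λ̂_U and makes the literal claim false. *)

(* Defs.v *)
From HB Require Import structures.
From mathcomp Require Import all_boot all_order all_algebra.
From mathcomp Require Import reals exp.

Set Implicit Arguments.
Unset Strict Implicit.
Unset Printing Implicit Defensive.

Import Order.TTheory GRing.Theory Num.Theory.

Local Open Scope ring_scope.

Section OddSets.
Variables (R : realType) (V : finType).
Implicit Types (e : rel V) (b : V -> nat) (y : V -> V -> R) (delta : R).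
Implicit Types (U : {set V}) (F : {set {set V}}).

Definition bnorm b U : nat := (\sum_(i in U) b i)%N.

Definition odd_sets b delta : {set {set V}} :=
  [set U | odd (bnorm b U) & (bnorm b U)%:R <= delta^-1].

Definition btilde b delta U : R :=
  (bnorm b U %/ 2)%:R - delta ^+ 2 * (bnorm b U)%:R ^+ 2 / 4.

(* The order on ranks selects one orientation of each undirected edge. *)
Definition edge_sum e y U : R :=
  \sum_(i in U) \sum_(j in U | e i j && (enum_rank i < enum_rank j)%N) y i j.

Definition lambda e b y delta U : R := edge_sum e y U / btilde b delta U.

(* lambda is a maximum over odd_sets; stated as a relation, so that no default
   value is needed when that family is empty. *)
Definition is_max_lambda e b y delta (m : R) : Prop :=
  (exists2 U, U \in odd_sets b delta & lambda e b y delta U = m) /\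
  (forall U, U \in odd_sets b delta -> lambda e b y delta U <= m).

Definition near_max e b y delta (m eps : R) : {set {set V}} :=
  [set U in odd_sets b delta | m - eps <= lambda e b y delta U].

(* The members of F all of whose vertices have b i > 0; this is F itself when
   b is positive. Adding a vertex with b i = 0 to U changes neither bnorm b U
   nor, when y has degree at most b, the value lambda U; hence arbitrary sets
   of such vertices can be added to a member of near_max, and near_max is
   neither laminar nor small unless they are disregarded. *)
Definition on_support b F : {set {set V}} :=
  [set U in F | U \subset [set i | (0 < b i)%N]].

Definition laminar F : Prop :=
  forall U U', U \in F -> U' \in F ->
    [\/ U :&: U' = U, U :&: U' = U' | U :&: U' = set0].

End OddSets.

(* Main.v *)
(* Let F(t) = (t-1)/2 - delta^2 t^2/4 be the denominator as a function of the
   norm t, and let A, B be near-maximal and intersecting. If the norm of A n B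
   is even, comparing A, B with A\B, B\A and paying the degrees of A n B
   contradicts lam >= 1 + 3 delta. If it is odd, comparing A, B with A n B,
   A u B and using that F(|A|) + F(|B|) - F(|A n B|) - F(|A u B|) =
   delta^2 p q/2, with p = |A\B|_b and q = |B\A|_b even, yields
   p q <= 1/2 + 2 eps/delta^3. For eps = delta^3 this forces p q = 0.
   For eps = delta^x put s = delta^((x-3)/2): two sets of the same norm with a
   common vertex have p = q = 2m with 1 <= m <= s, so by a rank argument at most
   n^s near-maximal sets share a given vertex and a given norm. There are at
   most n/delta pairs of a vertex and a norm. *)

Require Import Defs.
From HB Require Import structures.
From mathcomp Require Import all_boot all_order all_algebra.
From mathcomp Require Import reals exp.
From mathcomp Require Import ring lra zify.

Set Implicit Arguments.
Unset Strict Implicit.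
Unset Printing Implicit Defensive.

Import Order.TTheory GRing.Theory Num.Theory.

Local Open Scope ring_scope.

(** * Linear-algebra bound for sets through a common vertex *)

(* The polynomials prod_k (|A n X|_b - (l - 2(k+1))), made homogeneous of
   degree r by x_i = 1, span a space of dimension at most #|V| ^ r and are
   independent, being dual to the sets of F. *)
Lemma star_family_card (V : finType) (b : V -> nat) (i : V) (l r : nat)
    (F : {set {set V}}) :
  (forall A, A \in F -> i \in A /\ bnorm b A = l) ->
  (forall A B, A \in F -> B \in F -> A != B ->
     exists2 k, (k < r)%N & (bnorm b (A :&: B) + k.+1.*2 = l)%N) ->
  (#|F| <= #|V| ^ r)%N.
Proof.
move=> Fstar Fcross.
(* At the indicator of B the linear form [c A k] equals |A n B|_b - (l - 2(k+1)): its constant term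
   sits on coordinate [i], which every B in [F] contains. *)
pose c (A : {set V}) (k : 'I_r) (v : V) : rat :=
  (v \in A)%:R * (b v)%:R - (v == i)%:R * (l%:R - k.+1.*2%:R).
pose T := {ffun 'I_r -> V}.
pose fs (s : 'I_#|F|) : {set V} := enum_val s.
pose ft (t : 'I_#|T|) : T := enum_val t.
have fsF s : fs s \in F by exact: enum_valP.
have fs_inj : injective fs by exact: enum_val_inj.
have ft_bij : bijective ft by exact: enum_val_bij.
(* [P] holds the coefficients of the products of forms, indexed by r-tuples of vertices; [Q] holds
   the monomials evaluated at the members of [F]. *)
pose P : 'M[rat]_(#|F|, #|T|) :=
  \matrix_(s < #|F|, t < #|T|) \prod_k c (fs s) k (ft t k).
pose Q : 'M[rat]_(#|T|, #|F|) :=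
  \matrix_(t, s) \prod_k (ft t k \in fs s)%:R.
have PQ s u : (P *m Q) s u = \prod_(k < r)
    ((bnorm b (fs s :&: fs u))%:R - (l%:R - k.+1.*2%:R)).
  transitivity (\prod_(k < r) \sum_v
      c (fs s) k v * (v \in fs u)%:R).
    rewrite bigA_distr_bigA /= mxE [RHS](reindex _ (onW_bij _ ft_bij)) /=.
    by apply: eq_bigr => t _; rewrite !mxE -big_split.
  apply: eq_bigr => k _.
  have iu : i \in fs u by case: (Fstar _ (fsF u)).
  rewrite /c; under eq_bigr do rewrite mulrBl.
  rewrite sumrB; congr (_ - _); last first.
    rewrite (bigD1 i) //= big1 => [|v /negbTE ->]; last by rewrite !mul0r.
    by rewrite eqxx iu mul1r mulr1 addr0.
  rewrite /bnorm natr_sum [RHS]big_mkcond; apply: eq_bigr => v _.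
  by rewrite inE; do 2 case: (v \in _); rewrite ?mul0r ?mul1r ?mulr0 ?mulr1.
(* Off the diagonal some factor vanishes; on it the factors are 2(k+1). *)
have PQdiag : is_diag_mx (P *m Q).
  apply/is_diag_mxP => s u su; rewrite PQ.
  have fsu : fs s != fs u by rewrite (inj_eq fs_inj).
  have [k kr kl] := Fcross _ _ (fsF s) (fsF u) fsu.
  rewrite (bigD1 (Ordinal kr)) //= -kl natrD.
  by rewrite addrK subrr mul0r.
have PQunit : P *m Q \in unitmx.
  rewrite unitmxE.
  rewrite det_trig ?is_diag_mx_is_trig // unitfE.
  apply/prodf_neq0 => s _; rewrite PQ; apply/prodf_neq0 => k _.
  have [_ sl] := Fstar _ (fsF s).
  by rewrite setIid sl opprB addrC subrK pnatr_eq0.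
have : (\rank (P *m Q) <= #|T|)%N by exact: mulmx_max_rank.
by rewrite mxrank_unit // card_ffun card_ord.
Qed.

(** * Real inequalities for the denominator as a function of the norm *)

Section Numeric.
Variable R : realType.
Implicit Types d lam eps c p q t : R.

(** Agrees with [btilde] at odd norms, where the floor of t/2 is (t - 1)/2. *)
Definition btilde_fun d t : R := (t - 1) / 2 - d ^+ 2 * t ^+ 2 / 4.

(** With w = d t in [1, 2], (w - 1)(w - 2) <= 0 gives w^2 <= 3w - 2. The gain 3w/2 from 1 + 3d then
    outweighs 1/2 + w^2/4 by at least 3w/4, which absorbs the remaining terms of order d. *)
Lemma half_le_lam_btilde d lam t : 0 < d -> d <= 16^-1 -> 1 + 3 * d <= lam ->
  1 <= d * t -> d * t <= 2 -> t / 2 <= lam * btilde_fun d t.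
Proof.
move=> d0 d16 lamge dt1 dt2.
have d16' : d * 16 <= 1 by lra.
have t16 : 16 <= t by nra.
have FE : btilde_fun d t = t / 2 - 1 / 2 - (d * t) ^+ 2 / 4 by rewrite /btilde_fun; field.
have w2 : (d * t) ^+ 2 <= 3 * (d * t) - 2 by nra.
have F0 : 0 <= btilde_fun d t by rewrite FE; lra.
have /le_trans -> // : t / 2 <= (1 + 3 * d) * btilde_fun d t.
  rewrite FE; have : d * (d * t) ^+ 2 <= d * 4 by nra.
  set w := d * t in dt1 dt2 w2 *; move=> h.
  have -> : (1 + 3 * d) * (t / 2 - 1 / 2 - w ^+ 2 / 4) =
    t / 2 - 1 / 2 - w ^+ 2 / 4 + 3 * w / 2 - 3 * d / 2 - 3 * (d * w ^+ 2) / 4.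
    by rewrite /w; field.
  by lra.
by apply: ler_wpM2r.
Qed.

(** Bounds by eps/d the total loss that near-maximality of two sets allows. *)
Lemma btilde_le d t : 0 < d -> d * t <= 1 -> d * btilde_fun d t <= 2^-1.
Proof.
move=> d0 dt; rewrite /btilde_fun.
have : 0 <= d * (d * t) ^+ 2 by rewrite mulr_ge0 ?sqr_ge0 // ltW.
have -> : d * ((t - 1) / 2 - d ^+ 2 * t ^+ 2 / 4) =
  (d * t) / 2 - d / 2 - d * (d * t) ^+ 2 / 4 by field.
lra.
Qed.

(** Here c, p, q are the norms of A n B, A \ B, B \ A, and [EA], [EB], [EC], [ED] bound or equal the
    edge sums of A, B, A n B, A u B. The slack d^2/4 on [EC], which covers c = 1, turns pq into pq -
    1/2. *)
Lemma odd_uncross d lam eps c p q EA EB EC ED :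
  0 < d -> d <= 16^-1 -> 1 + 3 * d <= lam -> 0 <= eps ->
  d * (c + p) <= 1 -> d * (c + q) <= 1 ->
  (lam - eps) * btilde_fun d (c + p) <= EA -> (lam - eps) * btilde_fun d (c + q) <= EB ->
  EC <= lam * (btilde_fun d c + d ^+ 2 / 4) -> ED <= lam * btilde_fun d (c + p + q) ->
  EA + EB <= EC + ED -> d ^+ 3 * (p * q - 1 / 2) <= 2 * eps.
Proof.
move=> d0 d16 lamge eps0 da db hA hB hC hD h.
have [pq|pq] := leP (p * q - 1 / 2) 0.
  by apply: (@le_trans _ _ 0); [rewrite mulr_ge0_le0 // exprn_ge0 // ltW|lra].
have Ga := btilde_le d0 da; have Gb := btilde_le d0 db.
have key : lam * (d ^+ 2 / 2 * (p * q - 1 / 2)) <= eps * (btilde_fun d (c + p) + btilde_fun d (c + q)).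
  have -> : d ^+ 2 / 2 * (p * q - 1 / 2) =
    btilde_fun d (c + p) + btilde_fun d (c + q) - btilde_fun d c - btilde_fun d (c + p + q) - d ^+ 2 / 4.
    by rewrite /btilde_fun; field.
  by lra.
have s1 : d ^+ 2 / 2 * (p * q - 1 / 2) <= eps * (btilde_fun d (c + p) + btilde_fun d (c + q)).
  apply: le_trans key; rewrite ler_peMl //; last lra.
  by rewrite mulr_ge0 // ?divr_ge0 ?exprn_ge0 // ltW.
have s2 : d * (d ^+ 2 / 2 * (p * q - 1 / 2)) <=
          d * (eps * (btilde_fun d (c + p) + btilde_fun d (c + q))) by rewrite ler_wpM2l // ltW.
have s3 : eps * (d * btilde_fun d (c + p) + d * btilde_fun d (c + q)) <= eps * 1.
  by rewrite ler_wpM2l //; lra.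
have -> : d ^+ 3 * (p * q - 1 / 2) = 2 * (d * (d ^+ 2 / 2 * (p * q - 1 / 2))) by field.
lra.
Qed.

(** Passing to the differences lowers the denominators by at least c(1 - d) in total, slacks
    included, while degrees and near-maximality pay only c + d. But (1 + 3d)(1 - d)c - c = c d(2 -
    3d) > d once c >= 2. *)
Lemma even_uncross d lam eps c p q EA EB EP EQ :
  0 < d -> d <= 16^-1 -> 1 + 3 * d <= lam -> 0 <= eps -> eps <= d ^+ 2 ->
  2 <= c -> d * (c + p) <= 1 -> d * (c + q) <= 1 ->
  (lam - eps) * btilde_fun d (c + p) <= EA -> (lam - eps) * btilde_fun d (c + q) <= EB ->
  EP <= lam * (btilde_fun d p + d ^+ 2 / 4) -> EQ <= lam * (btilde_fun d q + d ^+ 2 / 4) ->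
  EA + EB <= EP + EQ + c -> False.
Proof.
move=> d0 d16 lamge eps0 epsd c2 da db hA hB hP hQ h.
have Ga := btilde_le d0 da; have Gb := btilde_le d0 db.
have s3 : eps * (d * btilde_fun d (c + p) + d * btilde_fun d (c + q)) <= d * d.
  rewrite -expr2 -[leRHS]mulr1; apply: le_trans (_ : eps * 1 <= _).
    by rewrite ler_wpM2l //; lra.
  by rewrite ler_wpM2r.
have s4 : eps * (btilde_fun d (c + p) + btilde_fun d (c + q)) <= d.
  rewrite -(ler_pM2l d0); apply: le_trans s3; rewrite le_eqVlt; apply/orP; left.
  by apply/eqP; ring.
have key : lam * (btilde_fun d (c + p) + btilde_fun d (c + q) - btilde_fun d p - btilde_fun d q - d ^+ 2 / 2)
    <= c + d by lra.
have FE : btilde_fun d (c + p) + btilde_fun d (c + q) - btilde_fun d p - btilde_fun d q - d ^+ 2 / 2 =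
  c - d * c * (d * (c + p) + d * (c + q)) / 2 + d ^+ 2 * (c ^+ 2 - 1) / 2.
  by rewrite /btilde_fun; field.
have s5 : c * (1 - d) <=
    btilde_fun d (c + p) + btilde_fun d (c + q) - btilde_fun d p - btilde_fun d q - d ^+ 2 / 2.
  rewrite FE.
  have : d * c * (d * (c + p) + d * (c + q)) <= d * c * 2.
    by rewrite ler_wpM2l ?mulr_ge0 //; lra.
  have : 0 <= d ^+ 2 * (c ^+ 2 - 1) by rewrite mulr_ge0 ?sqr_ge0 //; nra.
  by lra.
have s6 : (1 + 3 * d) * (c * (1 - d)) <= c + d.
  apply: le_trans key; apply: ler_pM => //; first lra.
  by rewrite mulr_ge0 //; lra.
have : 0 < c * (d * (2 - 3 * d)) - d.
  have : 2 * (d * (2 - 3 * d)) <= c * (d * (2 - 3 * d)).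
    by rewrite ler_wpM2r // mulr_ge0 //; lra.
  nra.
lra.
Qed.

End Numeric.

(** * Norms, edge sums and their uncrossing inequalities *)

Section OddSetUncrossing.
Variables (R : realType) (V : finType) (e : rel V) (b : V -> nat).
Variables (delta lam : R) (y : V -> V -> R).
Hypotheses (delta_gt0 : 0 < delta) (delta_le : delta <= 16^-1).
Hypotheses (y_sym : forall i j, y i j = y j i) (y_ge0 : forall i j, 0 <= y i j).
Hypotheses (y_diag : forall i, y i i = 0).
Hypotheses (y_off : forall i j, ~~ e i j -> y i j = 0).
Hypotheses (y_deg : forall i, \sum_(j | e i j) y i j <= (b i)%:R).
Hypotheses (lam_max : is_max_lambda e b y delta lam) (lam_ge : 1 + 3 * delta <= lam).
Implicit Types (A B U : {set V}) (eps : R).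

Local Notation support := [set i | (0 < b i)%N].

Lemma bnormID A B : bnorm b A = (bnorm b (A :&: B) + bnorm b (A :\: B))%N.
Proof. exact: big_setID. Qed.

Lemma bnormU A B : bnorm b (A :|: B) =
  (bnorm b (A :&: B) + bnorm b (A :\: B) + bnorm b (B :\: A))%N.
Proof. by rewrite (bnormID _ A) (setIidPr (subsetUl A B)) setDUl setDv set0U -bnormID. Qed.

Lemma bnorm_eq0 U : U \subset support -> bnorm b U = 0%N -> U = set0.
Proof.
move=> /subsetP Us /eqP; rewrite sum_nat_eq0 => /forall_inP U0.
apply/setP => i; rewrite inE; apply/negP => iU.
by have := Us _ iU; rewrite inE lt0n U0.
Qed.

Lemma y_rowsum_le i : \sum_j y i j <= (b i)%:R.
Proof.
rewrite (bigID (e i)) /= [X in _ + X]big1 ?addr0 // => j; exact: y_off.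
Qed.

(** Ordered pairs remove the rank orientation, so inequalities between edge sums reduce to
    inequalities between indicators, pair by pair. *)
Lemma edge_sum_double U :
  2 * edge_sum e y U = \sum_i \sum_j y i j * ((i \in U) && (j \in U))%:R.
Proof.
pose lt (i j : V) := (enum_rank i < enum_rank j)%N.
have E : edge_sum e y U =
    \sum_i \sum_j y i j * [&& i \in U, j \in U & lt i j]%:R.
  rewrite /edge_sum big_mkcond; apply: eq_bigr => i _.
  case: (i \in U); last by rewrite big1 // => j _; rewrite mulr0.
  rewrite big_mkcond; apply: eq_bigr => j _ /=; rewrite -/(lt i j).
  case: (j \in U) => //=; last by rewrite mulr0.
  case: (boolP (e i j)) => /= [_|/y_off ->]; last by rewrite mul0r.
  by case: (lt i j); rewrite ?mulr1 ?mulr0.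
rewrite mulr_natl mulr2n {1}E E [X in _ + X]exchange_big -big_split /=.
apply: eq_bigr => i _; rewrite -big_split /=; apply: eq_bigr => j _.
rewrite (y_sym j i) -mulrDr; have [->|ij] := eqVneq i j.
  by rewrite y_diag !mul0r.
congr (_ * _); rewrite (andbA (i \in U)) (andbA (j \in U)) (andbC (j \in U) (i \in U)).
case: ((i \in U) && _); rewrite ?addr0 //= -natrD.
have : enum_rank i != enum_rank j by rewrite (inj_eq enum_rank_inj).
by rewrite /lt -(inj_eq val_inj) /=; case: ltngtP.
Qed.

Lemma edge_sum_le U : edge_sum e y U <= (bnorm b U)%:R / 2.
Proof.
rewrite ler_pdivlMr // mulrC edge_sum_double /bnorm natr_sum [leRHS]big_mkcond.
apply: ler_sum => i _; case: (i \in U); last by rewrite big1 // => j _; rewrite mulr0.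
apply: le_trans (y_rowsum_le i); apply: ler_sum => j _.
by case: (j \in U); rewrite ?mulr1 // mulr0.
Qed.

(** On the support every vertex weighs at least 1, so norm 1 leaves room for a single vertex. *)
Lemma edge_sum_small U : U \subset support -> bnorm b U = 1%N -> edge_sum e y U = 0.
Proof.
move=> /subsetP Us U1; have U1' : (#|U| <= 1)%N.
  rewrite -U1 -sum1_card; apply: leq_sum => i /Us; by rewrite inE.
rewrite /edge_sum big1 // => i iU; rewrite big1 // => j /andP[jU /andP[_]].
by rewrite (card_le1_eqP U1' _ _ iU jU) ltnn.
Qed.

Lemma edge_sum_supermodular A B :
  edge_sum e y A + edge_sum e y B <= edge_sum e y (A :&: B) + edge_sum e y (A :|: B).
Proof.
suff : 2 * edge_sum e y A + 2 * edge_sum e y B <=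
       2 * edge_sum e y (A :&: B) + 2 * edge_sum e y (A :|: B) by lra.
rewrite !edge_sum_double -!big_split /=; apply: ler_sum => i _.
rewrite -!big_split /=; apply: ler_sum => j _; rewrite !inE -!mulrDr.
rewrite ler_wpM2l // -!natrD ler_nat.
by do 4 case: (_ \in _).
Qed.

Lemma edge_sum_differences A B :
  edge_sum e y A + edge_sum e y B <=
  edge_sum e y (A :\: B) + edge_sum e y (B :\: A) + (bnorm b (A :&: B))%:R.
Proof.
(* [S] weights a pair by its number of endpoints in A n B: two if the pair lies inside both A and B,
   at least one if it lies inside A or B but not inside a difference. *)
pose S := \sum_i \sum_j y i j * ((i \in A :&: B) + (j \in A :&: B))%:R.
have S_le : S <= 2 * (bnorm b (A :&: B))%:R.
  pose T := \sum_i \sum_j y i j * (i \in A :&: B)%:R.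
  have -> : S = 2 * T.
    rewrite mulr_natl mulr2n {2}/T exchange_big -big_split /=.
    apply: eq_bigr => i _; rewrite -big_split /=; apply: eq_bigr => j _.
    by rewrite (y_sym j i) natrD mulrDr.
  rewrite ler_pM2l // /bnorm natr_sum [leRHS]big_mkcond /=.
  apply: ler_sum => i _; rewrite -mulr_suml; have := y_rowsum_le i.
  by case: (_ \in _); rewrite ?mulr1 ?mulr0.
suff : 2 * edge_sum e y A + 2 * edge_sum e y B <=
       2 * edge_sum e y (A :\: B) + 2 * edge_sum e y (B :\: A) + S by lra.
rewrite !edge_sum_double /S -!big_split /=; apply: ler_sum => i _.
rewrite -!big_split /=; apply: ler_sum => j _; rewrite !inE -!mulrDr.
rewrite ler_wpM2l // -!natrD ler_nat.
by do 4 case: (_ \in _).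
Qed.

(** * Bounds on odd sets from the maximality of [lam] *)

Lemma btildeE U : odd (bnorm b U) ->
  btilde b delta U = btilde_fun delta (bnorm b U)%:R.
Proof.
move=> oU; rewrite /btilde /btilde_fun; congr (_ - _).
have {2}-> : bnorm b U = (bnorm b U %/ 2 * 2).+1 by lia.
by rewrite -natr1 addrK natrM mulfK ?pnatr_eq0.
Qed.

Lemma btilde_fun_gt0 (t : R) : 3 <= t -> delta * t <= 1 ->
  0 < btilde_fun delta t.
Proof.
move=> t3 dt; rewrite /btilde_fun.
have t0 : 0 <= t by lra.
have dt2 : (delta * t) ^+ 2 <= 1 by rewrite expr_le1 // mulr_ge0 // ltW.
rewrite -exprMn; lra.
Qed.

(* The bound persists past the size limit 1/delta of odd_sets, so that it
   applies to the union of two intersecting members: there the degree bound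
   and 1 + 3 delta <= lam take over. *)
Lemma odd_edge_sum_le U : odd (bnorm b U) -> (3 <= bnorm b U)%N ->
  delta * (bnorm b U)%:R <= 2 ->
  edge_sum e y U <= lam * btilde_fun delta (bnorm b U)%:R.
Proof.
move=> oU U3 dU2; have [dU1|dU1] := leP (delta * (bnorm b U)%:R) 1; last first.
  by apply: le_trans (edge_sum_le U) _; apply: half_le_lam_btilde => //; exact: ltW.
have Uodd : U \in odd_sets b delta by rewrite inE oU -[delta^-1]mulr1 ler_pdivlMl.
have := lam_max.2 _ Uodd; rewrite /lambda btildeE // ler_pdivrMr //.
by rewrite btilde_fun_gt0 // ler_nat.
Qed.

(* For norm 1 the edge sum is 0 but btilde is -delta^2/4, so the bound of
   odd_edge_sum_le is missed by lam * delta^2/4. *)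
Lemma odd_edge_sum_le_slack U : U \subset support -> odd (bnorm b U) ->
  delta * (bnorm b U)%:R <= 2 ->
  edge_sum e y U <= lam * (btilde_fun delta (bnorm b U)%:R + delta ^+ 2 / 4).
Proof.
move=> Us oU dU; have [U1|] := eqVneq (bnorm b U) 1%N.
  rewrite edge_sum_small // U1 /btilde_fun subrr expr1n mul0r mulr1 sub0r.
  by rewrite addNr mulr0.
move=> U1; have U3 : (3 <= bnorm b U)%N by move: oU U1; case: bnorm => [|[|[|]]].
apply: le_trans (odd_edge_sum_le oU U3 dU) _.
have := sqr_ge0 delta => d2.
by apply: ler_wpM2l; [have := lam_ge; have := delta_gt0; lra | lra].
Qed.

(** * Uncrossing near-maximal sets *)

(** Norm 1 is excluded because the edge sum is 0 there, while lam - eps is positive. *)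
Lemma near_maxP eps U : 0 <= eps -> eps <= delta ^+ 2 ->
  U \in on_support b (near_max e b y delta lam eps) ->
  [/\ U \subset support, odd (bnorm b U), (3 <= bnorm b U)%N,
      delta * (bnorm b U)%:R <= 1 &
      (lam - eps) * btilde_fun delta (bnorm b U)%:R <= edge_sum e y U].
Proof.
move=> eps0 epsd; rewrite !inE => /andP[/andP[/andP[oU]]].
rewrite -[delta^-1]mulr1 ler_pdivlMl // => dU hU Us.
have U3 : (3 <= bnorm b U)%N.
  have [U1|] := eqVneq (bnorm b U) 1%N; last first.
    by move: oU; case: bnorm => [|[|[|]]].
  move: hU; rewrite /lambda edge_sum_small // mul0r => ?; exfalso.
  have [d0 d16 lge] := And3 delta_gt0 delta_le lam_ge.
  have : delta ^+ 2 <= delta by rewrite expr2; apply: ler_piMl; lra.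
  lra.
split=> //; move: hU; rewrite /lambda btildeE // ler_pdivlMr //.
by rewrite btilde_fun_gt0 // ler_nat.
Qed.

Lemma near_max_uncross eps A B : 0 <= eps -> eps <= delta ^+ 2 ->
  A \in on_support b (near_max e b y delta lam eps) ->
  B \in on_support b (near_max e b y delta lam eps) ->
  A :&: B != set0 ->
  odd (bnorm b (A :&: B)) /\
  delta ^+ 3 * ((bnorm b (A :\: B))%:R * (bnorm b (B :\: A))%:R - 1 / 2) <= 2 * eps.
Proof.
move=> eps0 epsd /(near_maxP eps0 epsd)[As oA A3 dA hA].
move=> /(near_maxP eps0 epsd)[Bs oB B3 dB hB] AB0.
have AE := bnormID A B; have BE := bnormID B A; rewrite setIC in BE.
have UE := bnormU A B.
have Ps : A :\: B \subset support by rewrite (subset_trans _ As) // subsetDl.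
have Qs : B :\: A \subset support by rewrite (subset_trans _ Bs) // subsetDl.
have Cs : A :&: B \subset support by rewrite (subset_trans _ As) // subsetIl.
have C0 : (0 < bnorm b (A :&: B))%N.
  by rewrite lt0n; apply: contra AB0 => /eqP/bnorm_eq0 ->.
have dle (m k : nat) : (m <= k)%N -> delta * m%:R <= delta * k%:R.
  by move=> mk; rewrite ler_wpM2l ?ler_nat // ltW.
have dU2 : delta * (bnorm b (A :|: B))%:R <= 2.
  apply: le_trans (dle _ (bnorm b A + bnorm b B)%N _) _.
    by rewrite UE AE BE leq_add2l leq_addl.
  by rewrite natrD mulrDr -[2]/(1 + 1) lerD.
rewrite AE in dA hA oA A3; rewrite BE in dB hB oB.
have dC : delta * (bnorm b (A :&: B))%:R <= 2.
  by apply: le_trans (dle _ _ (leq_addr _ _)) (le_trans dA _); rewrite ler1n.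
have dP : delta * (bnorm b (A :\: B))%:R <= 2.
  by apply: le_trans (dle _ _ (leq_addl _ _)) (le_trans dA _); rewrite ler1n.
have dQ : delta * (bnorm b (B :\: A))%:R <= 2.
  by apply: le_trans (dle _ _ (leq_addl _ _)) (le_trans dB _); rewrite ler1n.
rewrite !natrD in dA hA dB hB.
have [oC|eC] := boolP (odd (bnorm b (A :&: B))).
  split=> //; apply: odd_uncross hA hB (odd_edge_sum_le_slack Cs oC dC) _
    (edge_sum_supermodular A B) => //.
  (* The norm of the union is c + p + q with c odd and p, q even, hence odd. *)
  rewrite -!natrD -UE; apply: odd_edge_sum_le => //; rewrite UE.
    by move: oA oB; rewrite !oddD oC; do 2 case: odd.
  exact: leq_trans A3 (leq_addr _ _).
have [oP oQ] : odd (bnorm b (A :\: B)) /\ odd (bnorm b (B :\: A)).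
  by move: oA oB; rewrite !oddD (negbTE eC).
exfalso; apply: even_uncross hA hB (odd_edge_sum_le_slack Ps oP dP)
  (odd_edge_sum_le_slack Qs oQ dQ) (edge_sum_differences A B) => //.
by rewrite ler_nat; move: eC C0; case: bnorm => [|[|]].
Qed.

Lemma near_max_even eps A B : 0 <= eps -> eps <= delta ^+ 2 ->
  A \in on_support b (near_max e b y delta lam eps) ->
  odd (bnorm b (A :&: B)) -> ~~ odd (bnorm b (A :\: B)).
Proof.
move=> eps0 epsd /(near_maxP eps0 epsd)[_ oA _ _ _] oC.
by move: oA; rewrite (bnormID A B) oddD oC addTb.
Qed.

Lemma near_max_bnormD_eq0 eps A B : 0 <= eps -> eps <= delta ^+ 2 ->
  A \in on_support b (near_max e b y delta lam eps) ->
  bnorm b (A :\: B) = 0%N -> A \subset B.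
Proof.
move=> eps0 epsd /(near_maxP eps0 epsd)[As _ _ _ _] /bnorm_eq0 D0.
by rewrite -setD_eq0 D0 // (subset_trans _ As) // subsetDl.
Qed.

(** * Laminarity *)

Lemma near_max_laminar :
  laminar (on_support b (near_max e b y delta lam (delta ^+ 3))).
Proof.
have eps0 : 0 <= delta ^+ 3 by rewrite exprn_ge0 // ltW.
have epsd : delta ^+ 3 <= delta ^+ 2.
  have [d0 d16] := conj delta_gt0 delta_le.
  by rewrite exprS ler_piMl ?sqr_ge0 //; lra.
move=> A B AF BF; have [->|AB0] := eqVneq (A :&: B) set0; first exact: Or33.
have [oC] := near_max_uncross eps0 epsd AF BF AB0.
rewrite [leRHS]mulrC ler_pM2l ?exprn_gt0 // -natrM => pq.
have p_even := near_max_even eps0 epsd AF oC.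
have q_even : ~~ odd (bnorm b (B :\: A)).
  by apply: near_max_even eps0 epsd BF _; rewrite setIC.
(* Uncrossing gives pq <= 5/2, whereas two positive even numbers have product at least 4. *)
have {}pq : (bnorm b (A :\: B) * bnorm b (B :\: A) < 3)%N.
  by rewrite -(ltr_nat R); move: pq; set w := (_ * _)%N; lra.
have : (bnorm b (A :\: B) == 0%N) || (bnorm b (B :\: A) == 0%N).
  move: p_even q_even pq; move: (bnorm b _) (bnorm b _).
  case=> [|[|p]] [|[|q]] //= _ _.
  by rewrite mulSn mulnS !addSn !addnS.
case/orP=> /eqP /(near_max_bnormD_eq0 eps0 epsd) sub.
- by constructor 1; apply/setIidPl/sub.
- by constructor 2; apply/setIidPr/sub.
Qed.

(** * Counting near-maximal sets *)

Lemma powR_delta_le x : 2 <= x -> delta `^ x <= delta ^+ 2.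
Proof.
move=> x2; have [d0 d16] := conj delta_gt0 delta_le.
by rewrite -(powR_mulrn 2 (ltW d0)) ger_powR // d0 /=; lra.
Qed.

Lemma near_max_star_card x i l : 2 <= x ->
  (#|[set A in on_support b (near_max e b y delta lam (delta `^ x)) |
      (i \in A) && (bnorm b A == l)]|
    <= #|V| ^ Num.truncn (delta `^ ((x - 3) / 2)))%N.
Proof.
move=> x2; set s := delta `^ ((x - 3) / 2).
have s0 : 0 <= s by exact: powR_ge0.
have eps0 : 0 <= delta `^ x by exact: powR_ge0.
have epsd := powR_delta_le x2.
have epsE : delta `^ x = delta ^+ 3 * s ^+ 2.
  rewrite -(powR_mulrn 2 s0) -(powR_mulrn 3 (ltW delta_gt0)) /s -powRrM -powRD.
    by congr (_ `^ _); field.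
  by rewrite (gt_eqF delta_gt0) implybT.
apply: (@star_family_card _ b i l) => [A|A B].
  by rewrite inE => /and3P[_ iA /eqP].
rewrite [A \in _]inE [B \in _]inE => /and3P[AF iA /eqP Al] /and3P[BF iB /eqP Bl] AB.
have AB0 : A :&: B != set0 by apply/set0Pn; exists i; rewrite inE iA.
have [oC] := near_max_uncross eps0 epsd AF BF AB0.
have p_even := near_max_even eps0 epsd AF oC.
have AE := bnormID A B; have BE := bnormID B A; rewrite setIC in BE.
have qp : bnorm b (B :\: A) = bnorm b (A :\: B).
  by apply/eqP; rewrite -(eqn_add2l (bnorm b (A :&: B))) -BE -AE Al Bl.
have p0 : bnorm b (A :\: B) != 0%N.
  apply: contra AB => /eqP p0; rewrite eqEsubset.
  by rewrite !(near_max_bnormD_eq0 eps0 epsd) // qp.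
have [k pk] : exists k, bnorm b (A :\: B) = k.+1.*2.
  move: p_even p0; case: (bnorm b (A :\: B)) => [|[|p]] //=.
  rewrite negbK => p_even _; exists p./2.
  by rewrite doubleS halfK (negbTE p_even) subn0.
rewrite qp pk epsE mulrCA ler_pM2l ?exprn_gt0 // => ks.
exists k; last by rewrite -pk -AE.
(* With m = k + 1 and p = q = 2m, [ks] reads 4m^2 - 1/2 <= 2s^2; m > s would force 2m^2 < 1/2,
   against m >= 1. *)
rewrite truncn_gt_nat; move: ks; rewrite -muln2 natrM.
have : 1 <= k.+1%:R :> R by rewrite ler1n.
move: (k.+1%:R : R) => m m1 ms; rewrite leNgt; apply/negP => sm.
have : s ^+ 2 < m ^+ 2 by rewrite ltr_pXn2r // nnegrE; lra.
have : 1 <= m ^+ 2 by rewrite expr_ge1 //; lra.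
lra.
Qed.

Lemma near_max_card x : 2 <= x ->
  #|on_support b (near_max e b y delta lam (delta `^ x))|%:R
    <= (#|V|%:R / delta) `^ (1 + delta `^ ((x - 3) / 2)).
Proof.
move=> x2; set F := on_support _ _; set s := delta `^ _.
have [d0 d16] := conj delta_gt0 delta_le.
have s0 : 0 <= s by exact: powR_ge0.
have eps0 : 0 <= delta `^ x by exact: powR_ge0.
have epsd := powR_delta_le x2.
have V1 : 1 <= #|V|%:R :> R.
  have [U + _] := lam_max.1; rewrite inE => /andP[oU _].
  rewrite ler1n lt0n; apply/negP => /eqP V0; move: oU; rewrite /bnorm big1 // => i.
  by have := fintype0 i V0.
pose L := Num.truncn delta^-1.
(* Norms range over 1, ..., [L], so the index in ['I_L] is the norm minus one. *)
pose G (q : V * 'I_L) :=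
  [set A in F | (q.1 \in A) && (bnorm b A == q.2.+1)].
have FG : F \subset \bigcup_q G q.
  apply/subsetP => A AF; have [_ oA A3 dA _] := near_maxP eps0 epsd AF.
  have [i iA] : exists i, i \in A.
    by apply/set0Pn; apply: contraL oA => /eqP ->; rewrite /bnorm big_set0.
  have AL : ((bnorm b A).-1 < L)%N.
    rewrite prednK; last exact: leq_trans A3.
    by rewrite truncn_ge_nat ?invr_ge0 ?(ltW d0) // -[delta^-1]mulr1 ler_pdivlMl.
  apply/bigcupP; exists (i, Ordinal AL) => //; rewrite inE AF iA /=.
  by rewrite prednK //; exact: leq_trans A3.
have FL : (#|F| <= #|V| * L * #|V| ^ Num.truncn s)%N.
  apply: leq_trans (subset_leq_card FG) _.
  apply: (@leq_trans (\sum_q #|G q|)).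
    elim/big_rec2: _ => [|q k B _ kB]; first by rewrite cards0.
    by apply: leq_trans (leq_card_setU _ _) _; rewrite leq_add2l.
  apply: (@leq_trans (\sum_(q : V * 'I_L) #|V| ^ Num.truncn s)).
    by apply: leq_sum => q _; exact: near_max_star_card.
  by rewrite sum_nat_const card_prod card_ord.
have N1 : 1 <= #|V|%:R / delta by rewrite ler_pdivlMr // mul1r; lra.
apply: (@le_trans _ _ ((#|V| * L * #|V| ^ Num.truncn s)%:R)); first by rewrite ler_nat.
rewrite powRD; last by rewrite (gt_eqF (lt_le_trans ltr01 N1)) implybT.
rewrite powRr1; last exact: le_trans ler01 N1.
rewrite !natrM natrX ler_pM ?mulr_ge0 ?exprn_ge0 //.
  by rewrite ler_wpM2l // truncn_le invr_ge0 ltW.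
(* Enlarging the base to |V|/delta >= 1 makes the power monotone in the exponent, so the truncation
   of s can be replaced by s. *)
apply: (@le_trans _ _ ((#|V|%:R / delta) ^+ Num.truncn s)).
  rewrite lerXn2r ?nnegrE //; first exact: le_trans ler01 N1.
  by rewrite ler_pdivlMr // ler_piMr //; lra.
rewrite -powR_mulrn; last exact: le_trans ler01 N1.
by rewrite ler_powR // truncn_le.
Qed.

End OddSetUncrossing.

Theorem theorem1 (R : realType) (V : finType) (n : nat) (e : rel V)
    (b : V -> nat) (delta : R) (y : V -> V -> R) (lam : R)
    (card_V : #|V| = n)
    (e_sym : symmetric e) (e_irr : irreflexive e)
    (delta_gt0 : 0 < delta) (delta_le : delta <= 16^-1)
    (y_sym : forall i j, y i j = y j i)
    (y_ge0 : forall i j, 0 <= y i j)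
    (y_diag : forall i, y i i = 0)
    (y_off : forall i j, ~~ e i j -> y i j = 0)
    (y_deg : forall i, \sum_(j | e i j) y i j <= (b i)%:R)
    (lam_max : is_max_lambda e b y delta lam)
    (lam_ge : 1 + 3 * delta <= lam) :
  laminar (on_support b (near_max e b y delta lam (delta ^+ 3))) /\
  (forall x : R, 2 <= x ->
     #|on_support b (near_max e b y delta lam (delta `^ x))|%:R
       <= n%:R ^+ 3 + (n%:R / delta) `^ (1 + delta `^ ((x - 3) / 2))).
Proof.
split; first exact: near_max_laminar.
(* The second summand bounds the count, and adding n^3 >= 0 preserves the bound. *)
move=> x x2; rewrite -card_V; apply: le_trans (near_max_card _ _ _ _ _ _ _ _ _ x2) _ => //.
by rewrite lerDr exprn_ge0.
Qed.
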